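(* The inducibility of every sparkler with at least four edges is at least $13/165$.
   Context: All trees are finite. For a tree $T$, $Z_k(T)$ denotes the number of $k$-vertex subtrees of $T$. An embedding of a tree $S$ in $T$ is a subtree of $T$ isomorphic to $S$ (so embeddings are counted as subgraphs, not as injective homomorphisms). The density $d(S,T)$ of a $k$-vertex tree $S$ in $T$ is the number of embeddings of $S$ in $T$ divided by $Z_k(T)$; if $T$ has fewer than $k$ vertices, $d(S,T)=0$. The inducibility of a tree $S$ is the maximum limit of $d(S,T_n)$ over sequences $(T_n)$ of trees with $|T_n|\to\infty$ for which the $k$-vertex tree densities converge for every $k$; equivalently, it is $\limsup_{n\to\infty}\max\{d(S,T): T \text{ is an } n\text{-vertex tree}\}$. A sparkler is a graph obtained from a star by subdividing one of its edges exactly once. *)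

(* Defs.v *)
From HB Require Import structures.
From mathcomp Require Import all_boot all_order all_algebra.
From mathcomp Require Import all_classical all_reals all_analysis.
Set Implicit Arguments.
Unset Strict Implicit.
Unset Printing Implicit Defensive.
Import Order.TTheory GRing.Theory Num.Theory.

(* A graph on a finite vertex type V is given by its adjacency relation. *)

Definition edges (V : finType) (e : rel V) : {set {set V}} :=
  [set [set p.1; p.2] | p in [set p : V * V | e p.1 p.2]].

Definition is_simple (V : finType) (e : rel V) : Prop :=
  symmetric e /\ irreflexive e.

Definition is_connected (V : finType) (e : rel V) : Prop :=
  0 < #|V| /\ forall x y : V, connect e x y.

(* The bound on the size is needed because [:: x; y] is a ucycle of e for
   every edge xy. *)
Definition is_acyclic (V : finType) (e : rel V) : Prop :=
  ~ exists c : seq V, 2 < size c /\ ucycle e c.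

Definition is_tree (V : finType) (e : rel V) : Prop :=
  [/\ is_simple e, is_connected e & is_acyclic e].

Definition isomorphic (V W : finType) (e : rel V) (g : rel W) : Prop :=
  exists f : V -> W, bijective f /\ forall x y : V, g (f x) (f y) = e x y.

(* H = (W, F) is a subgraph with vertex set W and edge set F; it need not be
   induced. *)
Definition is_subgraph (V : finType) (e : rel V)
    (H : {set V} * {set {set V}}) : bool :=
  (H.2 \subset edges e) && [forall f in H.2, f \subset H.1].

Definition sub_adj (V : finType) (H : {set V} * {set {set V}}) :
    rel {x : V | x \in H.1} :=
  fun x y => [set val x; val y] \in H.2.

Definition subtrees (V : finType) (e : rel V) (k : nat) : nat :=
  #|[set H : {set V} * {set {set V}} |
      [&& is_subgraph e H, #|H.1| == k & `[< is_tree (@sub_adj V H) >]]]|.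

Definition embeddings (S V : finType) (s : rel S) (e : rel V) : nat :=
  #|[set H : {set V} * {set {set V}} |
      [&& is_subgraph e H, `[< is_tree (@sub_adj V H) >]
        & `[< isomorphic s (@sub_adj V H) >]]]|.

Definition density (R : realType) (S V : finType) (s : rel S) (e : rel V) : R :=
  (if (#|V| < #|S|)%N then 0
   else (embeddings s e)%:R / (subtrees e #|S|)%:R)%R.

(* Every n-vertex tree has a copy with vertex type 'I_n, so the maximum is taken
   over labelled trees there. The default value 0 only matters for n = 0, since
   densities are nonnegative. *)
Definition max_density (R : realType) (S : finType) (s : rel S) (n : nat) : R :=
  \big[Num.max/0%R]_(E : {set 'I_n * 'I_n} |
      `[< is_tree (fun x y => (x, y) \in E) >])
    density R s (fun x y : 'I_n => (x, y) \in E).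

Definition inducibility (R : realType) (S : finType) (s : rel S) : \bar R :=
  limn_esup (fun n : nat => (max_density R s n)%:E).

Definition is_star (V : finType) (e : rel V) : Prop :=
  exists c : V, forall x y : V, e x y = (x != y) && ((x == c) || (y == c)).

(* None is the new vertex placed on the edge uv. *)
Definition subdivide (V : finType) (e : rel V) (u v : V) : rel (option V) :=
  fun x y =>
    match x, y with
    | Some a, Some b => e a b && ([set a; b] != [set u; v])
    | Some a, None | None, Some a => a \in [set u; v]
    | None, None => false
    end.

Definition is_sparkler (V : finType) (e : rel V) : Prop :=
  exists (W : finType) (g : rel W) (u v : W),
    [/\ is_star g, g u v & isomorphic e (subdivide g u v)].

(* Main.v *)
Require Import Defs.
From HB Require Import structures.
From mathcomp Require Import all_boot all_order all_algebra.
From mathcomp Require Import all_classical all_reals all_analysis.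
From mathcomp Require Import perm zify.
Set Implicit Arguments.
Unset Strict Implicit.
Unset Printing Implicit Defensive.
Import Order.TTheory GRing.Theory Num.Theory.

(* Consider a caterpillar whose spine is a path of N blocks of k vertices, the last
   vertex of each block (its hub) carrying D = 3k - 4 leaves. A k-vertex subtree
   with a leaf contains exactly one hub, so a subtree is given by its first spine
   vertex, at distance t < k from the next hub, and by at most k - 1 - t leaves of
   that hub. Since C(D, j - 1) <= C(D, j) / 2 for j < k, summing two geometric
   series bounds the number of subtrees by 4 N C(D, k - 1) <= 24 N C(D, k - 3). A
   sparkler arises from a hub that is not the last one, k - 3 of its leaves, and
   the two spine vertices before it or the two after it, which gives
   2 (N - 1) C(D, k - 3) copies. Hence the density is at least (N - 1) / (12 N),
   which exceeds 13/165 as soon as N > 18. *)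

(** * Trees presented by a parent relation *)

Lemma eq_set2 (T : finType) (a b c d : T) :
  ([set a; b] == [set c; d]) = (a == c) && (b == d) || (a == d) && (b == c).
Proof.
apply/eqP/idP => [/setP E|/orP[]/andP[/eqP-> /eqP->] //]; last exact: finset.setUC.
have := E a; have := E b; have := E c; have := E d.
rewrite !inE !eqxx ?orbT (eq_sym d) (eq_sym c) (eq_sym d b) (eq_sym c b).
by do 4 case: eqVneq => //= ?.
Qed.

Lemma mem_edges (V : finType) (e : rel V) (x y : V) :
  symmetric e -> ([set x; y] \in edges e) = e x y.
Proof.
move=> esym; apply/imsetP/idP => [[[a b]]|exy]; last by exists (x, y); rewrite ?inE.
rewrite inE /= => eab /eqP; rewrite eq_set2.
by case/orP=> /andP[/eqP-> /eqP->] //; rewrite esym.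
Qed.

Section Rooted.
Variable V : finType.

(** [P x y] says that [y] is the parent of [x]. The height [h] only has to drop at each step towards
    the root; it need not be the depth. *)
Record rooted (e P : rel V) (h : V -> nat) (r : V) : Prop := Rooted {
  rooted_adj : forall x y, e x y = P x y || P y x;
  rooted_height : forall x y, P x y -> h y < h x;
  rooted_uniq : forall x y z, P x y -> P x z -> y = z;
  rooted_ex : forall x, x != r -> exists y, P x y }.

Variables (e P : rel V) (h : V -> nat) (r : V).
Hypothesis eP : rooted e P h r.

Lemma rooted_sym : symmetric e.
Proof. by move=> x y; rewrite !(rooted_adj eP) orbC. Qed.

(** Climbing to the parent lowers [h], so every vertex is connected to [r]. On a cycle, both
    neighbours of a vertex of maximal height would be its parent, hence equal, which is impossible
    on more than two vertices. *)
Lemma rooted_tree : is_tree e.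
Proof.
have esym := rooted_sym.
have eroot x : connect e x r.
  have [n] := ubnP (h x); elim: n x => // n IHn x hx.
  have [->|/(rooted_ex eP)[y Pxy]] := eqVneq x r; first exact: connect0.
  apply: (@connect_trans _ _ y); first by rewrite connect1 // (rooted_adj eP) Pxy.
  by apply: IHn; have := rooted_height eP Pxy; lia.
split.
- split=> // x; rewrite (rooted_adj eP) orbb; apply/negP => /(rooted_height eP).
  by rewrite ltnn.
- split=> [|x y]; first by apply/card_gt0P; exists r.
  by apply: connect_trans (eroot x) _; rewrite (sym_connect_sym esym).
case=> c [c2 /andP[cyc unc]].
case: c => [//|x0 c'] in c2 cyc unc *; set c := x0 :: c' in c2 cyc unc *.
have x0c : x0 \in c by rewrite mem_head.
have [x xc xmax] : exists2 x, x \in c & forall y, y \in c -> h y <= h x.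
  by case: (arg_maxnP h x0c) => x xc xmax; exists x.
have down y : e x y -> y \in c -> P x y.
  by rewrite (rooted_adj eP) => /orP[//|/(rooted_height eP)] + /xmax; lia.
have [i p cE] := rot_to xc.
have memE y : (y \in c) = (y \in x :: p) by rewrite -cE mem_rot.
rewrite -(rot_cycle i) cE in cyc; rewrite -(rot_uniq i) cE in unc.
have sizeE : size c = (size p).+1 by rewrite -(size_rot i) cE.
case: p => [|y p] in cyc unc memE sizeE {cE} *; first by rewrite sizeE in c2.
case/lastP: p => [|p z] in cyc unc memE sizeE *; first by rewrite sizeE in c2.
move: cyc; rewrite /= rcons_path last_rcons => /and3P[exy _ ezx].
have yz : y = z.
  apply: (rooted_uniq eP (x := x)); apply: down; rewrite ?(esym x z) // memE.
  - by rewrite inE mem_head orbT.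
  - by rewrite !inE mem_rcons mem_head !orbT.
by move: unc; rewrite yz /= mem_rcons mem_head /= andbF.
Qed.

(* On a simple path a step down is followed by another step down, because the only
   way up leads back to the previous vertex. *)
Lemma rooted_path_down (E : rel V) (a : V) (p : seq V) :
    subrel E e -> path E a p -> uniq (a :: p) -> p != [::] ->
    (forall y, P a y -> y \notin p) ->
  exists2 y, y \in a :: p & E y (last a p) && P (last a p) y.
Proof.
move=> Ee; elim: p a => // b p IHp a /= /andP[Eab pathp] /andP[anp unp] _ up.
have Pba : P b a.
  by have := Ee _ _ Eab; rewrite (rooted_adj eP) => /orP[/up|//]; rewrite mem_head.
have [->|pn0] := eqVneq p [::]; first by exists a; rewrite ?mem_head //= Eab.
have [|y yp Ey] := IHp b pathp unp pn0.
- move=> y /(rooted_uniq eP Pba) <-.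
  by move: anp; rewrite inE negb_or => /andP[].
by exists y; rewrite // inE yp orbT.
Qed.

(** * Subtrees of a rooted tree *)

Section Subtree.
Variable H : {set V} * {set {set V}}.
Hypotheses (subH : is_subgraph e H) (connH : is_connected (@sub_adj V H)).

(** Take for [t] a vertex of least height. A simple path in [H] from [t] to [x] cannot start towards
    the parent of [t], so it descends all the way, and its last edge joins the parent of [x] to
    [x]. *)
Lemma rooted_subtree :
  exists2 t, t \in H.1 & (forall x, x \in H.1 -> h t <= h x) /\
    (forall x, x \in H.1 -> x != t ->
       exists2 y, y \in H.1 & P x y && ([set x; y] \in H.2)).
Proof.
case: connH => /card_gt0P[[x0 x0H] _] conn.
have [t tH tmin] : exists2 t, t \in H.1 & forall x, x \in H.1 -> h t <= h x.
  by case: (arg_minnP h x0H) => t tH tmin; exists t.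
exists t => //; split=> // x xH xt.
have /connectP[p0 pathp0] := conn (Sub t tH) (Sub x xH).
case/shortenP: pathp0 => p pathp unp _ lastE.
pose E : rel V := fun a b => [set a; b] \in H.2.
have Ee : subrel E e.
  move=> a b; case/andP: subH => /fintype.subsetP sub _ /sub.
  by rewrite mem_edges //; exact: rooted_sym.
have tpE : t :: map val p = map val (Sub t tH :: p :> seq {x : V | x \in H.1}).
  by [].
have lastE' : last t (map val p) = x by rewrite (last_map val p (Sub t tH)) -lastE.
have [|||y yp|y] := @rooted_path_down E t (map val p) Ee.
- exact: etrans (path_map (f := val) (e' := E) (Sub t tH) p) pathp.
- by rewrite tpE map_inj_uniq //; exact: val_inj.
- by apply: contra_neq xt; rewrite -lastE' => ->.
- apply/mapP => -[[z zH] _ /= yz]; have := rooted_height eP yp.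
  by rewrite yz ltnNge tmin.
rewrite lastE' => yp /andP[Eyx Pxy]; exists y; last by rewrite Pxy finset.setUC.
by move: yp; rewrite tpE => /mapP[[z zH] _ ->].
Qed.

(** An edge of [e] inside [H.1] joins some [a] to its parent, so [a] does not have least height in
    [H.1] and [H] has an edge from [a] to its only parent. Hence counting subtrees amounts to
    counting vertex sets. *)
Lemma subtree_induced : H.2 = [set f in edges e | f \subset H.1].
Proof.
have [t tH [tmin up]] := rooted_subtree.
apply/setP => f; rewrite inE; case/andP: subH => /fintype.subsetP H2e /forallP H21.
apply/idP/andP => [fH|[]].
  by split; [exact: H2e|move: (H21 f); rewrite fH].
case/imsetP=> -[a b]; rewrite inE /= => eab ->.
wlog Pab : a b {eab} / P a b.
  move: eab; rewrite (rooted_adj eP) => /orP[Pab|Pba] hyp; first exact: hyp.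
  by rewrite finset.setUC; exact: hyp.
rewrite finset.subUset !finset.sub1set => /andP[aH bH].
have [|y _ /andP[Pay]] := up a aH; last by rewrite (rooted_uniq eP Pab Pay).
by apply: contraTneq (rooted_height eP Pab) => ->; rewrite -leqNgt tmin.
Qed.

End Subtree.
End Rooted.

(** * Binomial sums and intervals *)

(** The ratio of the two coefficients is [(D - j + 1) / j]. *)
Lemma bin_double (D j : nat) : 3 * j <= D.+1 -> 0 < j -> 2 * 'C(D, j.-1) <= 'C(D, j).
Proof.
case: j => // j jD _ /=; rewrite -(leq_pmul2l (ltn0Sn j)) mul_bin_left mulnA.
by rewrite leq_mul2r; apply/orP; right; lia.
Qed.

Lemma sum_bin_le (D j : nat) : 3 * j <= D.+1 -> \sum_(i < j.+1) 'C(D, i) <= 2 * 'C(D, j).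
Proof.
elim: j => [|j IHj] jD; first by rewrite big_ord_recr big_ord0 /= !bin0.
rewrite big_ord_recr /=; have := bin_double jD isT.
have := IHj (leq_trans (leq_mul (leqnn 3) (leqnSn j)) jD); rewrite /=; lia.
Qed.

Lemma card_subsets_leq (T : finType) (j : nat) :
  #|[set L : {set T} | #|L| <= j]| = \sum_(i < j.+1) 'C(#|T|, i).
Proof.
elim: j => [|j IHj].
  rewrite big_ord_recr big_ord0 /= add0n -card_draws.
  by apply: eq_card => L; rewrite !inE leqn0.
rewrite big_ord_recr /= -IHj -card_draws -cardsUI.
rewrite (_ : _ :&: _ = finset.set0) ?cards0 ?addn0.
  by apply: eq_card => L; rewrite !inE leq_eqVlt orbC.
by apply/setP => L; rewrite !inE; apply/negP; lia.
Qed.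

Lemma sum_card_subsets (k D : nat) : 0 < k -> 3 * k.-1 <= D.+1 ->
  \sum_(t < k) #|[set L : {set 'I_D} | #|L| <= t]| <= 4 * 'C(D, k.-1).
Proof.
case: k => // k _ kD /=.
apply: (@leq_trans (\sum_(t < k.+1) 2 * 'C(D, t))).
  apply: leq_sum => t _; rewrite card_subsets_leq card_ord; apply: sum_bin_le.
  by have := ltn_ord t; lia.
by rewrite -big_distrr /=; have /= := sum_bin_le kD; lia.
Qed.

(** From [k - 2] to [k - 1] the coefficient grows by the factor [(2k - 2) / (k - 1) = 2]; from
    [k - 3] to [k - 2] by [(2k - 1) / (k - 2)], which is at most 3 exactly when [k] is at least
    5. *)
Lemma bin_triple_step (k : nat) : 5 <= k ->
  'C(3 * k - 4, k.-1) <= 6 * 'C(3 * k - 4, k - 3).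
Proof.
case: k => [//|[//|[//|k]]] k2; set D := 3 * k.+3 - 4.
rewrite (_ : k.+3 - 3 = k); last lia.
have E1 := mul_bin_left D k; have E2 := mul_bin_left D k.+1.
have D1 : D - k.+1 = 2 * k.+2 by lia.
have D2 : D - k <= 3 * k.+1 by lia.
have E3 : 'C(D, k.+2) = 2 * 'C(D, k.+1) by nia.
have E4 : 'C(D, k.+1) <= 3 * 'C(D, k) by nia.
by rewrite /= E3; lia.
Qed.

Lemma card_ord_itv (m a b : nat) : b <= m ->
  #|[set i : 'I_m | a <= i < b]| = b - a.
Proof.
have card_lt c : c <= m -> #|[set i : 'I_m | i < c]| = c.
  move=> cm; rewrite -sum1_card -[RHS]card_ord -sum1_card.
  by rewrite (big_ord_widen _ (fun=> 1) cm); apply: eq_bigl => i; rewrite inE.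
move=> bm; have [ab|ba] := leqP a b; last first.
  rewrite (eqP (ltnW ba)); apply: eq_card0 => i; rewrite !inE; lia.
rewrite -[in RHS](card_lt b bm) -[in RHS](card_lt a (leq_trans ab bm)) -cardsDS.
  by apply: eq_card => i; rewrite !inE -leqNgt.
by apply/fintype.subsetP => i; rewrite !inE => /leq_trans; apply.
Qed.

(** Each [i] in [I] brings along the whole range from [r] to [i], so [i - r < #|I|]. This gives one
    inclusion, and the cardinalities agree because [#|I| <= m - r] keeps the interval from being cut
    off at [m]. *)
Lemma interval_of_closed (m r l : nat) (I : {set 'I_m}) :
    r < m -> #|I| = l -> (forall i : 'I_m, i \in I -> r <= i) ->
    (forall i j : 'I_m, i \in I -> r <= j <= i -> j \in I) ->
  I = [set i : 'I_m | r <= i < r + l].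
Proof.
move=> rm <- Ir Icl.
have sub : I \subset [set i : 'I_m | r <= i < r + #|I|].
  apply/fintype.subsetP => i iI; rewrite inE Ir //= -ltn_subLR ?Ir // -ltnS -subSn ?Ir //.
  rewrite ltnS -(card_ord_itv r (ltn_ord i)).
  by apply: subset_leq_card; apply/fintype.subsetP => j; rewrite inE => /(Icl i); apply.
have Im : #|I| <= m - r.
  rewrite -(card_ord_itv r (leqnn m)); apply/subset_leq_card/fintype.subsetP => i.
  by rewrite inE ltn_ord andbT => /Ir.
by apply/eqP; rewrite eqEcard sub card_ord_itv ?addKn //; lia.
Qed.

(** * Sparklers *)

Section SparklerGraph.
Variable V : finType.

(* The star centred at c on all vertices but t, plus the pendant edge mt. *)
Definition spark (c m t : V) : rel V := fun x y =>
  [|| [&& x == c, y != c & y != t], [&& y == c, x != c & x != t],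
      (x == m) && (y == t) | (x == t) && (y == m)].

Lemma spark_rooted (c m t : V) : c != m -> c != t -> m != t ->
  rooted (spark c m t)
    (fun x y => if x == t then y == m else (x != c) && (y == c))
    (fun x => if x == c then 0 else if x == t then 2 else 1) c.
Proof.
move=> cm ct mt; split=> [x y|x y|x y z|x xc] /=.
- rewrite /spark.
  have [->|xt] := eqVneq x t.
    rewrite (eq_sym t c) (negPf ct) (eq_sym t m) (negPf mt) /= andbF /=.
    by have [->|yt] := eqVneq y t; rewrite ?(eq_sym t m) ?(negPf mt) ?andbF ?orbF.
  by have [->|yt] := eqVneq y t; rewrite ?(eq_sym t c) ?(negPf ct) ?andbF ?andbT ?orbF //=;
    case: (x == c); rewrite ?(negPf ct) ?(eq_sym t c) ?(negPf ct) //; case: (y == c).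
- have [->|_] := eqVneq x t; first move/eqP=> ->.
    by rewrite (eq_sym t c) (eq_sym m c) (negPf ct) (negPf cm) (negPf mt).
  by case/andP=> /negPf -> /eqP ->; rewrite eqxx.
- case: ifP => _; first by move=> /eqP -> /eqP ->.
  by move=> /andP[_ /eqP ->] /andP[_ /eqP ->].
- have [_|_] := eqVneq x t; first by exists m.
  by exists c; rewrite xc eqxx.
Qed.

End SparklerGraph.

(** Start from any bijection and correct it at [c], [m] and [t] in turn by composing with a
    transposition; distinctness of the points keeps the earlier corrections intact. *)
Lemma spark_bij (V W : finType) (c m t : V) (c' m' t' : W) : #|V| = #|W| ->
    c != m -> c != t -> m != t -> c' != m' -> c' != t' -> m' != t' ->
  exists2 f : V -> W, bijective f & [/\ f c = c', f m = m' & f t = t'].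
Proof.
move=> VW cm ct mt cm' ct' mt'.
pose f0 x := enum_val (cast_ord VW (enum_rank x)).
have f0I : injective f0.
  by move=> x y /enum_val_inj/cast_ord_inj/enum_rank_inj.
have fix_pt (f : V -> W) x y : injective f -> exists2 f' : V -> W, injective f' &
    f' x = y /\ forall z, f z != y -> z != x -> f' z = f z.
  move=> fI; exists (tperm (f x) y \o f) => [z z' /= /perm_inj/fI //|].
  by split=> [|z fzy zx] /=; rewrite ?tpermL // tpermD // eq_sym // (inj_eq fI).
have [f1 f1I [f1c _]] := fix_pt f0 c c' f0I.
have [f2 f2I [f2m f2E]] := fix_pt f1 m m' f1I.
have f2c : f2 c = c' by rewrite f2E ?f1c.
have [f3 f3I [f3t f3E]] := fix_pt f2 t t' f2I.
exists f3; first exact: inj_card_bij f3I (eq_leq (esym VW)).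
by split=> //; rewrite f3E ?f2c ?f2m.
Qed.

Lemma sparkler_spark (V : finType) (s : rel V) : is_sparkler s ->
  exists c m t, [/\ c != m, c != t, m != t & s =2 spark c m t].
Proof.
case=> W [g [u [v [[c gE] guv [f [[f' fK f'K] sE]]]]]].
(* One end of the subdivided edge is the centre of the star, and [subdivide] is symmetric in the two
   ends. The other end becomes the tip and [None] the middle vertex. *)
wlog uc : u v guv sE / u = c.
  move=> hyp; move: (guv); rewrite gE => /andP[_ /orP[]/eqP]; first exact: hyp guv sE.
  apply: (hyp v u); first by move: guv; rewrite !gE (eq_sym v u) (orbC (v == c)).
  by move=> x y; rewrite -sE /subdivide finset.setUC.
subst u; have cv : c != v by move: guv; rewrite gE => /andP[].
exists (f' (Some c)), (f' None), (f' (Some v)).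
split; rewrite ?(inj_eq (can_inj f'K)) //.
move=> x y; rewrite -sE /spark.
rewrite -!(can2_eq fK f'K) /subdivide.
case: (f x) (f y) => [a|] [b|]; rewrite ?gE ?eq_set2 ?inE ?(inj_eq Some_inj) //=.
- rewrite andbF orbF.
  have [->|ac] := eqVneq a c.
    by rewrite (negPf cv) /= (eq_sym c b) !andbT andbF !orbF.

  by have [->|_] := eqVneq b c; rewrite /= ?ac ?andbT ?andbF //.
- by rewrite !andbT.
- by rewrite andbT orbF.
Qed.

Lemma eq_rooted (V : finType) (e e' P : rel V) (h : V -> nat) (r : V) :
  e =2 e' -> rooted e P h r -> rooted e' P h r.
Proof. by move=> ee' [adj ? ? ?]; split=> // x y; rewrite -ee'. Qed.

(** This turns the hypothesis of four edges into five vertices, as [bin_triple_step] requires. There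
    are at most [#|V| - 2] edges at the centre, and one pendant edge. *)
Lemma card_edges_spark (V : finType) (s : rel V) (c m t : V) :
  c != t -> s =2 spark c m t -> #|edges s| < #|V|.
Proof.
move=> ct sE.
have card_ct : #|[set c; t]| = 2 by rewrite cards2 ct.
have V2 : 2 <= #|V| by rewrite -card_ct max_card.
have sub : edges s \subset [set [set c; x] | x in ~: [set c; t]] :|: [set [set m; t]].
  apply/fintype.subsetP => _ /imsetP[[x y] + ->]; rewrite inE /= sE => /or4P[].
  - case/and3P=> /eqP-> yc yt; apply/finset.setUP; left; apply/imsetP.
    by exists y; rewrite // !inE negb_or yc.
  - case/and3P=> /eqP-> xc xt; apply/finset.setUP; left; apply/imsetP.
    by exists x; [rewrite !inE negb_or xc|exact: finset.setUC].
  - by case/andP=> /eqP-> /eqP->; rewrite !inE eqxx orbT.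
  - by case/andP=> /eqP-> /eqP->; rewrite [ [set t; m] ]finset.setUC !inE eqxx orbT.
apply: leq_ltn_trans (subset_leq_card sub) _.
apply: leq_ltn_trans (leq_card_setU _ _) _; rewrite cards1 addn1.
by rewrite -(cardsC [set c; t]) card_ct add2n !ltnS leq_imset_card.
Qed.

Section Copy.
Variables (V T : finType) (s : rel V) (e : rel T) (c m t : V).
Hypotheses (cm : c != m) (ct : c != t) (mt : m != t) (sE : s =2 spark c m t).
Variables (x y z : T) (L : {set T}).
Hypotheses (esym : symmetric e) (yz : y != z) (xz : x != z).
Hypotheses (eL : forall a, a \in y |: L -> e x a) (eyz : e y z).
Hypotheses (xL : x \notin y |: L) (zL : z \notin L) (yL : y \notin L).
Hypothesis cardL : #|L| + 3 = #|V|.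

(** Here [x] is the centre, [y] the middle vertex, [z] the tip and [L] the set of other leaves. *)
Definition spark_copy : {set T} * {set {set T}} :=
  (x |: (z |: (y |: L)), [set y; z] |: [set [set x; a] | a in y |: L]).

Let H := spark_copy.

Lemma spark_copy_embedding :
  [&& is_subgraph e H, `[< is_tree (@sub_adj T H) >]
    & `[< isomorphic s (@sub_adj T H) >]].
Proof.
have xH : x \in H.1 by rewrite !inE eqxx.
have yH : y \in H.1 by rewrite !inE eqxx !orbT.
have zH : z \in H.1 by rewrite !inE eqxx !orbT.
have xy : x != y by move: xL; rewrite !inE negb_or => /andP[].
have zyL : z \notin y |: L by rewrite !inE negb_or eq_sym yz.
have memH a : a \in H.1 -> (a \in y |: L) = (a != x) && (a != z).
  rewrite !in_setU1; have [->|ax] := eqVneq a x.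
    by move: xL; rewrite in_setU1 => /negPf ->.
  by have [->|az] /= := eqVneq a z; first by move: zyL; rewrite in_setU1 => /negPf ->.
pose X : {a : T | a \in H.1} := Sub x xH.
pose Y : {a : T | a \in H.1} := Sub y yH.
pose Z : {a : T | a \in H.1} := Sub z zH.
have adjE : spark X Y Z =2 @sub_adj T H.
  move=> [a aH] [b bH]; rewrite /spark /sub_adj -!val_eqE /=.
  rewrite in_setU1 eq_set2 -!memH //.
  apply/idP/orP => [/or4P[]|[]].
  - by case/andP=> /eqP-> bL; right; apply/imsetP; exists b.
  - by case/andP=> /eqP-> aL; right; rewrite finset.setUC; apply/imsetP; exists a.
  - by move=> ->; left.
  - by rewrite andbC => ->; left; rewrite orbT.
  - by case/orP=> ->; rewrite ?orbT // andbC => ->; rewrite !orbT.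
  - case/imsetP=> d dL /eqP; rewrite eq_set2.
    by case/orP=> /andP[/eqP-> /eqP->]; rewrite eqxx dL ?orbT.
have XY : X != Y by [].
have XZ : X != Z by [].
have YZ : Y != Z by [].
apply/and3P; split.
- apply/andP; split.
    apply/fintype.subsetP => A /setU1P[->|/imsetP[a aL ->]].
      by rewrite mem_edges.
    by rewrite mem_edges // eL.
  apply/forallP => A; apply/implyP => /setU1P[->|/imsetP[a aL ->]];
    rewrite finset.subUset !finset.sub1set ?xH ?yH ?zH //=.
  by rewrite /H /= !in_setU1 in aL *; rewrite aL !orbT.
- by apply/asboolP; apply: rooted_tree (eq_rooted adjE (spark_rooted XY XZ YZ)).
- apply/asboolP.
  have cardH : #|V| = #|{: {a : T | a \in H.1}}|.
    rewrite card_sig -cardL /H /= -(_ : #|x |: (z |: (y |: L))| = #|L| + 3) //.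
    have xzyL : x \notin z |: (y |: L) by rewrite in_setU1 negb_or xz.
    by rewrite cardsU1 xzyL cardsU1 zyL cardsU1 yL !add1n addn3.
  have [f fbij [fc fm ft]] := spark_bij cardH cm ct mt XY XZ YZ.
  exists f; split=> // a b.
  by rewrite -adjE sE /spark -fc -fm -ft !(inj_eq (bij_inj fbij)).
Qed.

End Copy.

(** * The caterpillar *)

Section Caterpillar.
Variables N k D : nat.
Hypotheses (N_gt0 : 0 < N) (k_gt1 : 1 < k).

Definition hub (q : nat) : nat := q * k + k.-1.

Definition cat_parent (x y : 'I_(N * k) + 'I_N * 'I_D) : bool :=
  match x, y with
  | inl i, inl j => j.+1 == i :> nat
  | inr (q, _), inl i => i == hub q :> nat
  | _, inr _ => false
  end.

(** The value [N * k] for leaves exceeds every spine position, so a leaf is higher than all spine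
    vertices and not only its hub. *)
Definition cat_height (x : 'I_(N * k) + 'I_N * 'I_D) : nat :=
  if x is inl i then i else N * k.

Lemma hub_lt (q : 'I_N) : hub q < N * k.
Proof.
have : q.+1 * k <= N * k by rewrite leq_mul2r ltn_ord orbT.
by rewrite mulSn /hub; lia.
Qed.

Lemma spine_gt0 : 0 < N * k.
Proof. by rewrite muln_gt0 N_gt0 ltnW. Qed.

Definition hub_ord (q : 'I_N) : 'I_(N * k) := Ordinal (hub_lt q).

Variables (V : finType) (f : 'I_(N * k) + 'I_N * 'I_D -> V).
Variable g : V -> 'I_(N * k) + 'I_N * 'I_D.
Hypotheses (fK : cancel f g) (gK : cancel g f).

(** The tree is transported along a bijection because [max_density] takes only trees on ['I_n]. *)
Definition caterpillar : rel V :=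
  fun x y => cat_parent (g x) (g y) || cat_parent (g y) (g x).

Lemma cat_rooted :
  rooted caterpillar (relpre g cat_parent) (cat_height \o g)
    (f (inl (Ordinal spine_gt0))).
Proof.
split=> [x y //|x y|x y z|x]; rewrite /relpre /=.
- case: (g x) (g y) => [i|[q j]] [i'|[q' j']] //= /eqP <-; exact: ltnSn.
- move=> Pxy Pxz; apply: (can_inj gK); move: Pxy Pxz.
  case: (g x) (g y) (g z) => [i|[q j]] [i'|[q' j']] [i''|[q'' j'']] //=.
    by move=> /eqP E1 /eqP E2; congr inl; apply: val_inj => /=; lia.
  by move=> /eqP E1 /eqP E2; congr inl; apply: val_inj => /=; lia.
- rewrite eq_sym (can2_eq fK gK); case: (g x) => [i|[q j]] hx.
  + have i1 : i.-1 < N * k by have := ltn_ord i; lia.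
    exists (f (inl (Ordinal i1))); rewrite fK /= prednK //.
    rewrite lt0n; apply: contraNN hx => /eqP i0.
    by apply/eqP; congr inl; apply: val_inj; rewrite /= i0.
  + by exists (f (inl (hub_ord q))); rewrite fK /=.
Qed.

(* The k-vertex subtree whose first spine vertex has position t in block q and whose set of
   leaves, all in block q, is L. *)
Definition window (q : 'I_N) (t : 'I_k) (L : {set 'I_D}) : {set V} :=
  [set x | match g x with
    | inl i => q * k + t <= i < q * k + t + (k - #|L|)
    | inr (q', j) => (q' == q) && (j \in L)
    end].

Lemma subtree_window (H : {set V} * {set {set V}}) :
    is_subgraph caterpillar H -> is_connected (@sub_adj V H) -> #|H.1| = k ->
  exists (q : 'I_N) (t : 'I_k) (L : {set 'I_D}), #|L| <= t /\ H.1 = window q t L.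
Proof.
move=> subH connH cardH; set W := H.1 in cardH *.
have [t0 t0W [tmin tup]] := rooted_subtree cat_rooted subH connH.
rewrite -/W /= in t0W tmin tup *.
have up x : x \in W -> x != t0 -> exists2 y, y \in W & cat_parent (g x) (g y).
  by move=> xW xt; have [y yW /andP[Pxy _]] := tup x xW xt; exists y.
(* The lowest vertex is on the spine: otherwise, as [k > 1], there is another vertex, and its parent
   is a spine vertex in [W], lower than any leaf. *)
have [r t0E] : exists r, t0 = f (inl r).
  case E : (g t0) => [r|p]; first by exists r; rewrite -E gK.
  have [x] : exists x, x \in W :\ t0.
    by apply/card_gt0P; have := cardsD1 t0 W; rewrite t0W; lia.
  rewrite !inE => /andP[xt xW]; have [y yW] := up x xW xt.
  case Ey : (g y) => [i|//]; last by case: (g x) => [?|[]].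
  by have := tmin y yW; rewrite E Ey /= => leNi; have := ltn_ord i; lia.
subst t0.
pose I := [set i | f (inl i) \in W]; pose J := [set p | f (inr p) \in W].
have cardW : #|I| + #|J| = k.
  have inlI : injective (fun i => f (inl i)) by move=> i j /(can_inj fK)[].
  have inrI : injective (fun p => f (inr p)) by move=> i j /(can_inj fK)[].
  rewrite -(card_imset _ inlI) -(card_imset _ inrI).
  apply: etrans cardH; rewrite -cardsUI addnC.
  rewrite (_ : _ :&: _ = finset.set0) ?cards0 ?add0n.
    apply: eq_card => x; rewrite !inE; apply/orP/idP.
      by case=> /imsetP[y]; rewrite inE => + ->.
    by case E : (g x) => [i|p] xW; [left|right]; apply/imsetP;
      [exists i|exists p]; rewrite ?inE -E ?gK.
  apply/setP => x; rewrite !inE; apply/negP.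
  by case/andP=> /imsetP[i _ ->] /imsetP[p _] /(can_inj fK).
have parentW x y : x \in W -> x != f (inl r) -> cat_parent (g x) y -> f y \in W.
  move=> xW xr Pxy; have [z zW Pxz] := up x xW xr.
  rewrite (rooted_uniq cat_rooted (x := x) (y := f y) (z := z)) //.
  by rewrite /= fK.
have Imin i : i \in I -> r <= i by rewrite inE => /tmin; rewrite !fK.
(* The spine part is closed under parents down to [r], hence an interval starting at [r]. *)
have Icl (i j : 'I_(N * k)) : i \in I -> r <= j <= i -> j \in I.
  have [n] := ubnP i; elim: n i => // n IHn i iN iI /andP[rj ji].
  have [ij|ij] := eqVneq (j : nat) i; first by rewrite (val_inj ij).
  have i1 : i.-1 < N * k by have := ltn_ord i; lia.
  apply: (IHn (Ordinal i1)); rewrite /= ?rj /=; try lia.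
  rewrite inE in iI; rewrite inE; apply: (parentW _ _ iI).
    by rewrite (can_eq fK); apply/eqP => -[E]; move: rj ji ij; rewrite E; lia.
  by rewrite fK /=; apply/eqP; lia.
have [l cardI] : exists l, #|I| = l by exists #|I|.
rewrite cardI in cardW; have IE := interval_of_closed (ltn_ord r) cardI Imin Icl.
have rI : r \in I by rewrite inE.
have hubI q j : (q, j) \in J -> hub_ord q \in I.
  rewrite !inE => qjW; apply: (parentW _ _ qjW); last by rewrite fK /=.
  by rewrite (can_eq fK).
have qN : r %/ k < N by rewrite ltn_divLR; [exact: ltn_ord|lia].
have tk : r %% k < k by rewrite ltn_mod; lia.
pose q := Ordinal qN; pose t := Ordinal tk.
have rE : r = q * k + t :> nat by rewrite /= -divn_eq.
(* A leaf leaves fewer than [k] vertices for the spine interval. Starting in block [q], such an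
   interval can reach the hub of [q] but not the next one. *)
have Jq q' j : (q', j) \in J -> q' = q.
  move=> qjJ; have lk : l < k.
    by apply: leq_trans (eq_leq cardW); rewrite -addn1 leq_add2l; apply/card_gt0P; exists (q', j).
  have := hubI _ _ qjJ; rewrite IE inE /= rE /hub => /andP[h1 h2].
  apply: ord_inj; have tlt := ltn_ord t.
  have h3 : q * k < q'.+1 * k by rewrite mulSn; lia.
  have h4 : q' * k < q.+1 * k by rewrite mulSn; lia.
  move: h3 h4; rewrite !ltn_mul2r !ltnS => /andP[_ h3] /andP[_ h4].
  by apply: anti_leq; rewrite h4 h3.
pose L := [set j | (q, j) \in J].
have JL : #|J| = #|L|.
  have pairI : injective (pair q : 'I_D -> _) by move=> i j [].
  rewrite -(card_imset _ pairI); apply: eq_card => -[q' j].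
  apply/idP/imsetP => [qjJ|[j']]; last by rewrite inE => + ->.
  by exists j; rewrite ?inE -?(Jq _ _ qjJ) //; move: qjJ; rewrite inE.
have LE : #|L| = k - l by rewrite -cardW JL addKn.
exists q, t, L; rewrite /window LE.
split.
  (* If there is a leaf, the interval of length [l] from offset [t] reaches offset [k - 1], so
     [k - l <= t]. *)
  have [L0|[j]] := set_0Vmem L; first by rewrite -LE L0 cards0.
  rewrite inE => /hubI; rewrite IE inE /= rE /hub => /andP[_ hlt].
  have := ltn_ord t; lia.
apply/setP => x; rewrite inE; case E : (g x) => [i|[q' j]].
  have -> : (x \in W) = (i \in I) by rewrite inE -E gK.
  rewrite IE inE -rE; by rewrite subKn // -cardW leq_addr.
have -> : (x \in W) = ((q', j) \in J) by rewrite inE -E gK.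
apply/idP/andP => [qjJ|[/eqP-> ]]; last by rewrite inE.
by split; [rewrite (Jq _ _ qjJ)|rewrite inE -(Jq _ _ qjJ)].
Qed.

(** Triples [(q, t, L)] map onto a set containing all subtrees. Some windows run past the end of the
    spine and give no [k]-vertex subtree, which is harmless for an upper bound. *)
Lemma subtrees_caterpillar_le :
  subtrees caterpillar k <= N * \sum_(t < k) #|[set L : {set 'I_D} | #|L| <= t]|.
Proof.
pose F (p : 'I_N * ('I_k * {set 'I_D})) : {set V} * {set {set V}} :=
  let W := window p.1 p.2.1 p.2.2 in (W, [set e in edges caterpillar | e \subset W]).
pose A := [set p : 'I_k * {set 'I_D} | #|p.2| <= p.1].
have cardA : #|A| = \sum_(t < k) #|[set L : {set 'I_D} | #|L| <= t]|.
  rewrite -sum1_card (eq_bigl (fun p : 'I_k * {set 'I_D} => true && (#|p.2| <= p.1))); last first.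
    by move=> p; rewrite inE.
  rewrite -(pair_big_dep xpredT (fun (t : 'I_k) (L : {set 'I_D}) => #|L| <= t) (fun _ _ => 1)).
  by apply: eq_bigr => t _; rewrite sum1dep_card.
rewrite -cardA -[X in X * _]card_ord -cardsT -cardsX.
apply: leq_trans (leq_imset_card F _).
apply/subset_leq_card/fintype.subsetP => H; rewrite inE.
case/and3P => subH /eqP cardH /asboolP[_ connH _].
have [q [t [L [Lt WE]]]] := subtree_window subH connH cardH.
apply/imsetP; exists (q, (t, L)); first by rewrite !inE.
rewrite /F /= -WE -(subtree_induced cat_rooted subH connH).
by case: H {subH cardH connH WE}.
Qed.
End Caterpillar.

(** * Sparklers in the caterpillar *)

Section CaterpillarEmbeddings.
Variables N k D : nat.
Hypothesis k_gt3 : 3 < k.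
Variables (T : finType) (f : 'I_(N.+1 * k) + 'I_N.+1 * 'I_D -> T).
Variable g : T -> 'I_(N.+1 * k) + 'I_N.+1 * 'I_D.
Hypotheses (fK : cancel f g) (gK : cancel g f).
Variables (V : finType) (s : rel V) (c m t : V).
Hypotheses (cm : c != m) (ct : c != t) (mt : m != t) (sE : s =2 spark c m t).
Hypothesis cardV : #|V| = k.

Lemma embeddings_caterpillar_ge :
  N * 2 * 'C(D, k - 3) <= embeddings s (caterpillar g).
Proof.
have k_gt1 : 1 < k by lia.
have Nk_gt0 : 0 < N.+1 * k by apply: spine_gt0.
pose sp i : 'I_(N.+1 * k) := insubd (Ordinal Nk_gt0) i.
have spE i : i < N.+1 * k -> sp i = i :> nat by move=> iN; rewrite val_insubd iN.
have spK i j : i < N.+1 * k -> j < N.+1 * k -> (f (inl (sp i)) == f (inl (sp j))) = (i == j).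
  move=> iN jN; rewrite (can_eq fK).
  by apply/eqP/eqP => [[/(congr1 val)]|-> //]; rewrite /= !spE.
(* Of the [N.+1] hubs the last is left out, so that two spine vertices follow each hub used. *)
pose wq (q : 'I_N) : 'I_N.+1 := widen_ord (leqnSn N) q.
have hubN (q : 'I_N) : hub k q + 2 < N.+1 * k.
  have : q.+1 * k <= N * k by rewrite leq_mul2r ltn_ord orbT.
  by rewrite !mulSn /hub; lia.
pose mid q (b : bool) := if b then (hub k q).-1 else (hub k q).+1.
pose tip q (b : bool) := if b then (hub k q).-2 else (hub k q).+2.
pose lv (q : 'I_N) (L : {set 'I_D}) := [set f (inr (wq q, j)) | j in L].
pose F (p : ('I_N * bool) * {set 'I_D}) := let: (q, b, L) := p in
  spark_copy (f (inl (sp (hub k q)))) (f (inl (sp (mid q b))))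
    (f (inl (sp (tip q b)))) (lv q L).
pose A := finset.setX [set: 'I_N * bool] [set L : {set 'I_D} | #|L| == k - 3].
have lvE q L q' j : (f (inr (q', j)) \in lv q L) = (q' == wq q) && (j \in L).
  apply/imsetP/andP => [[j' jL /(can_inj fK)[-> ->]]|[/eqP-> jL]]; first by rewrite eqxx.
  by exists j.
have lvl q L i : (f (inl i) \in lv q L) = false.
  by apply/negbTE/imsetP => -[j _ /(can_inj fK)].
(* Since [k > 3], the copy has a leaf at its hub, which reveals [q], and then [L]. The direction [b]
   is read off from whether the spine vertex just before the hub belongs to the copy. *)
have FI : {in A &, injective F}.
  move=> [[q b] L] [[q' b'] L']; rewrite !inE /= => /eqP cardL /eqP cardL' [/setP E _].
  have El j : (j \in L) = (q == q') && (j \in L').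
    have := E (f (inr (wq q, j))).
    by rewrite !in_setU1 !lvE !(can_eq fK) eqxx /= => ->.
  have [j jL] : exists j, j \in L by apply/card_gt0P; rewrite cardL; lia.
  have qq : q = q' by move: jL; rewrite El => /andP[/eqP].
  subst q'; have -> : L = L' by apply/setP => j'; rewrite El eqxx.
  have := E (f (inl (sp (mid q true)))).
  rewrite !in_setU1 !lvl /mid /tip !orbF.
  have := hubN q; rewrite /hub => hq.
  by case: b b' E => [] [] E; rewrite ?spK //; lia.
have <- : #|F @: A| = N * 2 * 'C(D, k - 3).
  by rewrite card_in_imset // cardsX cardsT card_prod card_ord card_bool card_draws card_ord.
apply/subset_leq_card/fintype.subsetP => _ /imsetP[[[q b] L] + ->].
rewrite !inE /= => /eqP cardL.
have hq := hubN q.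
have hq2 : 2 <= hub k q by rewrite /hub; lia.
have midN : mid q b < N.+1 * k by rewrite /mid; case: (b); lia.
have tipN : tip q b < N.+1 * k by rewrite /tip; case: (b); lia.
apply: (spark_copy_embedding cm ct mt sE).
- exact: rooted_sym (cat_rooted _ k_gt1 fK gK).
- by rewrite spK // /mid /tip; case: (b); lia.
- by rewrite spK ?/tip //; case: (b); lia.
- move=> a /setU1P[->|/imsetP[j _ ->]]; rewrite /caterpillar !fK /= ?spE //; try lia.
  by rewrite /mid; case: (b); lia.
- by rewrite /caterpillar !fK /= !spE // /mid /tip; case: (b); lia.
- by rewrite in_setU1 lvl orbF spK ?/mid //; case: (b); lia.
- by rewrite lvl.
- by rewrite lvl.
- rewrite card_imset; first by rewrite cardL cardV; lia.
  by move=> j j' /(can_inj fK)[].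
Qed.
End CaterpillarEmbeddings.

(** * Passage to the limit superior *)

Lemma limn_esup_ge (R : realType) (u : nat -> \bar R) (l : \bar R) :
  (forall n0, exists2 n, n0 <= n & (l <= u n)%E) -> (l <= limn_esup u)%E.
Proof.
move=> lu; rewrite limn_esup_lim; apply: lime_ge; first exact: is_cvg_esups.
near=> n0; have [n n0n lun] := lu n0.
by apply: le_trans lun _; apply: ereal_sup_ubound; exists n.
Unshelve. all: by end_near. Qed.

Lemma embeddings_le_subtrees (V T : finType) (s : rel V) (e : rel T) :
  embeddings s e <= subtrees e #|V|.
Proof.
apply/subset_leq_card/fintype.subsetP => H; rewrite !inE => /and3P[-> -> iso].
rewrite andbT /=; have /asboolP[f [/bij_eq_card -> _]] := iso.
by rewrite card_sig.
Qed.

Theorem theorem13 (R : realType) (V : finType) (s : rel V)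
    (sparkler_s : is_sparkler s) (edges_s : (4 <= #|edges s|)%N) :
  (((13%:R / 165%:R : R)%R)%:E <= inducibility R s)%E.
Proof.
have [c [m [t [cm ct mt sE]]]] := sparkler_spark sparkler_s.
have [k kE] : exists k, k = #|V| by exists #|V|.
have k_ge5 : 4 < k by rewrite kE; apply: leq_ltn_trans edges_s (card_edges_spark ct sE).
apply: limn_esup_ge => n0.
(* With [N.+1] blocks the density is at least [N / (12 (N + 1))], and this is at least [13/165] iff
   [9 N >= 156], that is, [N >= 18]. Adding [n0] makes the tree large enough. The choice of [D]
   gives [3 * k.-1 = D.+1], the extreme case of [sum_card_subsets]. *)
pose N := n0 + 18; pose D := 3 * k - 4.
pose C : finType := ('I_(N.+1 * k) + 'I_N.+1 * 'I_D)%type.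
pose f : C -> 'I_#|C| := enum_rank; pose g : 'I_#|C| -> C := enum_val.
have fK : cancel f g := @enum_rankK C.
have gK : cancel g f := @enum_valK C.
exists #|C|.
  rewrite card_sum card_ord; apply: leq_trans (leq_addr _ _).
  by apply: leq_trans (leq_pmulr _ _); rewrite /N; lia.
rewrite lee_fin /max_density.
pose e := caterpillar g.
pose E := [set p : 'I_#|C| * 'I_#|C| | e p.1 p.2].
have eE : (fun x y => (x, y) \in E) = e.
  by apply/funext => x; apply/funext => y; rewrite inE.
have k_gt1 : 1 < k by lia.
have rooted_e := cat_rooted (ltn0Sn N) k_gt1 fK gK.
apply: le_trans (le_bigmax_cond _ _ (_ : `[< is_tree (fun x y => (x, y) \in E) >])); last first.
  by apply/asboolP; rewrite eE; apply: rooted_tree rooted_e.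
rewrite eE /density -kE.
have lb := embeddings_caterpillar_ge (ltnW k_ge5) fK gK cm ct mt sE (esym kE).
have ub := subtrees_caterpillar_le (ltn0Sn N) k_gt1 fK gK.
have le_sub := embeddings_le_subtrees s e; rewrite -kE in le_sub.
have sum_le : \sum_(i < k) #|[set L : {set 'I_D} | #|L| <= i]| <= 4 * 'C(D, k.-1).
  by apply: sum_card_subsets; rewrite /D; lia.
have bin_le := bin_triple_step k_ge5.
have bin_gt : 0 < 'C(D, k - 3) by rewrite bin_gt0 /D; lia.
rewrite -/e in lb ub; rewrite -/D in bin_le.
set emb := embeddings s e in lb le_sub *; set sub := subtrees e k in ub le_sub *.
have emb_gt0 : 0 < emb by apply: leq_trans lb; rewrite !muln_gt0 bin_gt /N addn_gt0 orbT.
(* Positivity is needed to clear the denominator, as division by zero would give 0. *)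
have sub_gt0 : 0 < sub := leq_trans emb_gt0 le_sub.
have main : 13 * sub <= emb * 165.
  have ub' : sub <= N.+1 * (24 * 'C(D, k - 3)).
    by apply: leq_trans ub _; rewrite leq_mul2l; apply/orP; right; lia.
  move: lb ub' bin_gt; move: ('C(D, k - 3)) => B; rewrite /N; nia.
(* This rules out the default value 0 in [density]. *)
have k_le : k <= #|C|.
  by rewrite card_sum card_ord; apply: leq_trans (leq_addr _ _); rewrite leq_pmull.
rewrite card_ord ltnNge k_le /=.
rewrite ler_pdivlMr ?ltr0n // mulrAC ler_pdivrMr ?ltr0n //.
by rewrite -!natrM ler_nat.
Qed.
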